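(* Let $0\le a<b<\infty$, and let $f:[a,b]\to\mathbb{R}$ be continuous on $[a,b]$ with $f\in L[a,b]$. Let $p,q>0$ be fixed. If $f$ is $P$-convex on $[a,b]$ (that is, $f\in P([a,b])$), then $$\int_a^b (x-a)^p(b-x)^q f(x)f(a+b-x)\,dx \le (b-a)^{p+q+1}\{f(a)+f(b)\}^2\,\beta(p+1,q+1).$$
   Context: A function $f:I\to\mathbb{R}$ on an interval $I$ is $P$-convex (belongs to the class $P(I)$) if it is nonnegative and $f(\lambda x+(1-\lambda)y)\le f(x)+f(y)$ for all $x,y\in I$ and $\lambda\in[0,1]$. $\beta(m,n)=\int_0^1 t^{m-1}(1-t)^{n-1}\,dt$ for $m,n>0$ is the Euler Beta function. $L[a,b]$ denotes the integrable functions on $[a,b]$. *)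

(* Defs.v *)
From mathcomp Require Import all_boot all_order all_algebra.
From mathcomp Require Import all_classical all_reals all_analysis.

Set Implicit Arguments.
Unset Strict Implicit.
Unset Printing Implicit Defensive.

Import Order.TTheory GRing.Theory Num.Theory.
Import numFieldNormedType.Exports.

Local Open Scope classical_set_scope.
Local Open Scope ring_scope.

(* A function on the interval I is a total function f : R -> R of which only
   the values on I matter. *)
Definition P_convex (R : realType) (I : interval R) (f : R -> R) : Prop :=
  (forall x : R, x \in I -> 0 <= f x) /\
  (forall x y l : R, x \in I -> y \in I -> 0 <= l <= 1 ->
     f (l * x + (1 - l) * y) <= f x + f y).

(* Meant for m, n > 0, where the integral is finite; unlike the library's
   beta_fun, the parameters are real. When m < 1 or n < 1 the convention
   0 `^ r = 0 (r <> 0) sets the integrand to 0 at the singular endpoint, which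
   does not affect the integral. *)
Definition Beta (R : realType) (m n : R) : R :=
  (\int[@lebesgue_measure R]_(t in `[0%R, 1%R])
     (t `^ (m - 1) * (1 - t) `^ (n - 1)))%R.

(* Main.v *)
Require Import Defs.
From mathcomp Require Import all_boot all_order all_algebra.
From mathcomp Require Import all_classical all_reals all_analysis.
From mathcomp Require Import ring lra.
Import Order.TTheory GRing.Theory Num.Theory.
Import numFieldNormedType.Exports.
Local Open Scope classical_set_scope.
Local Open Scope ring_scope.

(* P-convexity with the endpoints a and b bounds f by f a + f b on the whole of
   [a, b], hence also bounds f (a + b - x). What remains is the integral of the
   weight (x - a)^p (b - x)^q, which x = a + (b - a) t reduces to Beta. *)

(** Serves outer functions that are continuous only relative to [B], such as a real power on the
    half-line or [f] on its segment. As [f] maps [A] into [B], it pulls relative neighbourhoods in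
    [B] back to relative neighbourhoods in [A]. *)
Lemma within_continuous_comp_in {T U V : topologicalType} (A : set T)
    (B : set U) (f : T -> U) (g : U -> V) :
  (forall x, A x -> B (f x)) -> continuous f -> {within B, continuous g} ->
  {within A, continuous (g \o f)}.
Proof.
move=> AB cf /subspace_continuousP cg; apply/subspace_continuousP => x Ax.
apply: (cvg_comp f g (G := within B (nbhs (f x)))); last exact/cg/AB.
move=> W nW.
have : \forall y \near x, B (f y) -> W (f y) := cf x _ nW.
by apply: filterS => y Wfy Ay; exact/Wfy/AB.
Qed.

Lemma within_continuousM {R : realType} (A : set R) (f g : R -> R) :
  {within A, continuous f} -> {within A, continuous g} ->
  {within A, continuous (f \* g)}.
Proof. by move=> cf cg x; apply: cvgM; [exact: cf|exact: cg]. Qed.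

(** The half-line is essential: [powR] takes the value 1 at negative bases, so at 0 only the limit
    from the right agrees with the value 0. *)
Lemma within_continuous_powR {R : realType} (r : R) : 0 < r ->
  {within `[0, +oo[, continuous (fun x : R => x `^ r)}.
Proof.
move=> r0; apply/continuous_within_itvcyP; split.
  move=> x x0; apply: differentiable_continuous.
  by apply/derivable1_diffP; exact: derivable_powR.
by rewrite powR0 ?gt_eqF//; exact: powR_cvg0.
Qed.

Lemma continuous_subr {R : realType} (c : R) : continuous (fun x => x - c).
Proof. by move=> x; apply: cvgB => //; exact: cvg_cst. Qed.

Lemma continuous_subl {R : realType} (c : R) : continuous (fun x => c - x).
Proof. by move=> x; apply: cvgB => //; exact: cvg_cst. Qed.

Lemma within_continuous_weight {R : realType} (a b p q : R) :
  0 < p -> 0 < q ->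
  {within `[a, b], continuous (fun x => (x - a) `^ p * (b - x) `^ q)}.
Proof.
move=> p_gt0 q_gt0; apply: within_continuousM.
- apply: (@within_continuous_comp_in R R R _ `[0, +oo[ (fun x => x - a)
    (fun x => x `^ p)).
  + by move=> x /=; rewrite !in_itv/= andbT subr_ge0 => /andP[].
  + exact: continuous_subr.
  + exact: within_continuous_powR.
- apply: (@within_continuous_comp_in R R R _ `[0, +oo[ (fun x => b - x)
    (fun x => x `^ q)).
  + by move=> x /=; rewrite !in_itv/= andbT subr_ge0 => /andP[].
  + exact: continuous_subl.
  + exact: within_continuous_powR.
Qed.

Lemma Rintegral_weight {R : realType} (a b p q : R) :
  a < b -> 0 < p -> 0 < q ->
  \int[@lebesgue_measure R]_(x in `[a, b]) ((x - a) `^ p * (b - x) `^ q) =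
  (b - a) `^ (p + q + 1) * Beta (p + 1) (q + 1).
Proof.
move=> ab p_gt0 q_gt0; have ba0 : 0 < b - a by rewrite subr_gt0.
pose F t : R := a + (b - a) * t.
have F0 : F 0 = a by rewrite /F mulr0 addr0.
have F1 : F 1 = b by rewrite /F mulr1 addrC subrK.
have cF : continuous F.
  by move=> x; apply: cvgD; [exact: cvg_cst|apply: cvgMr; exact: cvg_id].
have dF (x : R) : is_derive x (1 : R) F (b - a).
  by rewrite /F; apply: is_derive_eq; rewrite add0r mul1r -[LHS]/(_ * _) mulr1.
have F' : F^`()%classic = cst (b - a).
  by apply/funext => x; rewrite derive1E derive_val.
(* [t - 0] makes the integrand an instance of the weight, with a = 0, b = 1. *)
have -> : Beta (p + 1) (q + 1) =
    \int[@lebesgue_measure R]_(t in `[0, 1]) ((t - 0) `^ p * (1 - t) `^ q).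
  by rewrite /Beta !addrK; apply: eq_Rintegral => t _; rewrite subr0.
rewrite -RintegralZl//; last first.
  apply: continuous_compact_integrable; first exact: segment_compact.
  exact: within_continuous_weight.
rewrite /Rintegral; congr fine.
(* Only the bounds of the left integral are rewritten, to [F 0] and [F 1], the form in which the
   change of variables applies. *)
rewrite -{1}F0 -{1}F1 integration_by_substitution_increasing//; first last.
- by rewrite F0 F1; exact: within_continuous_weight.
- split.
  + by move=> x _; exact: ex_derive.
  + by apply: cvg_at_right_filter; exact: cF.
  + by apply: cvg_at_left_filter; exact: cF.
- by rewrite F'; exact: is_cvg_cst.
- by rewrite F'; exact: is_cvg_cst.
- by rewrite F' => x _; exact: cvg_cst.
- by move=> x y _ _ xy; rewrite /F ltrD2l ltr_pM2l.
apply: eq_integral => t; rewrite inE/= in_itv/= => /andP[t0 t1].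
rewrite F' !fctE /F subr0; congr EFin.
have -> : a + (b - a) * t - a = (b - a) * t by ring.
have -> : b - (a + (b - a) * t) = (b - a) * (1 - t) by ring.
(* The two bases release [b - a] to the powers [p] and [q]; the derivative of [F] supplies the
   remaining 1 in the exponent [p + q + 1]. *)
rewrite !powRM ?subr_ge0 ?(ltW ab)//.
rewrite !powRD ?(gt_eqF ba0) ?implybT// powRr1 ?(ltW ba0)//; ring.
Qed.

Lemma P_convex_le {R : realType} (a b x : R) (f : R -> R) :
  P_convex `[a, b] f -> x \in `[a, b] -> f x <= f a + f b.
Proof.
move=> [_ fP]; rewrite in_itv/= => /andP[ax xb].
(* The quotient by [b - a] used below is meaningless on a one-point interval; there [x = a], and
   P-convexity with weight 1 suffices. *)
have [ab|ab] := eqVneq a b.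
  have := fP a b 1; rewrite mul1r subrr mul0r addr0 -ab !in_itv/= lexx ler01.
  have -> : x = a by apply/eqP; rewrite eq_le ax ab xb.
  by rewrite lexx; exact.
have ba0 : 0 < b - a by rewrite subr_gt0 lt_neqAle ab (le_trans ax).
(* The weight of [a] is the relative distance from [x] to [b]. *)
have -> : x = (b - x) / (b - a) * a + (1 - (b - x) / (b - a)) * b.
  by field; rewrite gt_eqF.
apply: fP; rewrite ?in_itv/= ?lexx ?(le_trans ax xb)//.
apply/andP; split; first by rewrite divr_ge0 ?(ltW ba0) ?subr_ge0.
by rewrite ler_pdivrMr// mul1r lerD2l lerN2.
Qed.

Theorem theorem3 (R : realType) (a b p q : R) (f : R -> R)
  (a_ge0 : 0 <= a) (ab : a < b)
  (f_cont : {within `[a, b], continuous f})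
  (f_int : (@lebesgue_measure R).-integrable `[a, b] (EFin \o f))
  (p_gt0 : 0 < p) (q_gt0 : 0 < q)
  (f_P : P_convex `[a, b] f) :
  (\int[@lebesgue_measure R]_(x in `[a, b])
     ((x - a) `^ p * (b - x) `^ q * f x * f (a + b - x)))%R
  <= (b - a) `^ (p + q + 1) * (f a + f b) ^+ 2 * Beta (p + 1) (q + 1).
Proof.
have cw := within_continuous_weight a b p q p_gt0 q_gt0.
have refl_itv x : x \in `[a, b] -> a + b - x \in `[a, b].
  by rewrite !in_itv/= => /andP[? ?]; apply/andP; split; lra.
(* The power of [b - a] and the Beta value are folded back into the integral of the weight, and the
   constant moves under it, so that two integrands remain to be compared. *)
rewrite mulrAC -Rintegral_weight// -RintegralZr//; last first.
  by apply: continuous_compact_integrable; [exact: segment_compact|].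
apply: le_Rintegral => //.
- apply: continuous_compact_integrable; first exact: segment_compact.
  apply: within_continuousM; first exact: within_continuousM.
  apply: (@within_continuous_comp_in R R R _ `[a, b] (fun x => a + b - x) f) => //.
  exact: continuous_subl.
- apply: continuous_compact_integrable; first exact: segment_compact.
  by apply: within_continuousM => // x; exact: cvg_cst.
(* The bounds on [f x] and [f (a + b - x)] may be multiplied because both values are nonnegative. *)
- move=> x xab; rewrite -mulrA ler_wpM2l ?mulr_ge0 ?powR_ge0// expr2.
  have [f_ge0 _] := f_P.
  by rewrite ler_pM ?P_convex_le ?f_ge0 ?refl_itv.
Qed.
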